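(* Let $p\in(0,1)$ and let $x,t$ be real numbers with $t>0$. For $i\ge 1$ set $x_i=\left(\frac{1}{p^i}-1\right)x-t$. Then for every integer $k\ge 0$, $k!\,P_k(x_1,\ldots,x_k)=(-1)^k(t)_k\,M_k(x,t,p)$, where $P_k$ is the $k$-th Kailath-Segall polynomial and $M_k(x,t,p)$ is the $k$-th Meixner polynomial of the first kind.
   Context: The Kailath-Segall polynomials $P_n(x_1,\ldots,x_n)$ in the indeterminates $x_1,x_2,\ldots$ are defined by $P_0=1$ and, for $n\ge 1$, by the recursion $P_n=\frac1n\left(P_{n-1}x_1-P_{n-2}x_2+\cdots+(-1)^{n+1}P_0x_n\right)$, where $P_j$ abbreviates $P_j(x_1,\ldots,x_j)$. Equivalently, as formal power series, $\sum_{n\ge 0}P_n(x_1,\ldots,x_n)z^n=\exp\left(\sum_{n\ge 1}\frac{(-1)^{n+1}}{n}x_nz^n\right)$. Here $(t)_k=t(t+1)\cdots(t+k-1)$, with $(t)_0=1$. The Meixner polynomials of the first kind $M_k(x,t,p)$ are characterized by $\sum_{k\ge 0}(-1)^k(t)_k\,M_k(x,t,p)\frac{z^k}{k!}=\left(\frac{1+z/p}{1+z}\right)^x(1+z)^{-t}$. *)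

(* Defs.v *)
From Stdlib Require Import Arith Factorial Reals Lra Lia List ClassicalEpsilon.
From Coquelicot Require Import Coquelicot.
Import ListNotations.
Open Scope R_scope.

(* [kailath_segall_rev x n] is the list [P_n; P_(n-1); ...; P_0] of values at
   x_i := x i; only the x i with i >= 1 occur. *)
Fixpoint kailath_segall_rev (x : nat -> R) (n : nat) : list R :=
  match n with
  | O => [1]
  | S m =>
      let l := kailath_segall_rev x m in
      (1 / INR (S m) *
         sum_f_R0 (fun i => (-1) ^ i * (nth i l 0 * x (S i))) m) :: l
  end.

Definition kailath_segall (n : nat) (x : nat -> R) : R :=
  nth 0 (kailath_segall_rev x n) 0.

Lemma kailath_segall_0 (x : nat -> R) : kailath_segall 0 x = 1.
Proof. reflexivity. Qed.

Lemma nth_kailath_segall_rev (x : nat -> R) (n i : nat) :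
  (i <= n)%nat ->
  nth i (kailath_segall_rev x n) 0 = kailath_segall (n - i) x.
Proof.
revert i; induction n as [|n IH]; intros [|i] Hi; try reflexivity; try lia.
simpl Nat.sub; rewrite <- IH by lia; reflexivity.
Qed.

Lemma kailath_segall_S (x : nat -> R) (m : nat) :
  kailath_segall (S m) x =
  1 / INR (S m) *
    sum_f_R0 (fun i => (-1) ^ i * (kailath_segall (m - i) x * x (S i))) m.
Proof.
unfold kailath_segall at 1; cbn [kailath_segall_rev nth].
f_equal; apply sum_eq; intros i Hi.
now rewrite nth_kailath_segall_rev.
Qed.

Fixpoint pochhammer (t : R) (k : nat) : R :=
  match k with
  | O => 1
  | S j => pochhammer t j * (t + INR j)
  end.

(* Generating-function identity for k |-> M_k(x,t,p).  It is required for z in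
   some neighbourhood of 0, where both bases of [Rpower] are positive. *)
Definition is_meixner (x t p : R) (M : nat -> R) : Prop :=
  locally 0 (fun z : R =>
    is_pseries (fun k => (-1) ^ k * pochhammer t k * M k / INR (fact k)) z
      (Rpower ((1 + z / p) / (1 + z)) x * Rpower (1 + z) (- t))).

(* For 0 < p < 1 and 0 < t exactly one sequence satisfies [is_meixner x t p]:
   the right-hand side is analytic at 0 and (t)_k <> 0.  Outside this range the
   value of [meixner] carries no meaning. *)
Definition meixner (k : nat) (x t p : R) : R :=
  epsilon (inhabits (fun _ : nat => 0)) (is_meixner x t p) k.

(* Main.v *)
Require Import Defs.
From Stdlib Require Import Arith Factorial Reals Lra Lia ClassicalEpsilon.
From Coquelicot Require Import Coquelicot.
Open Scope R_scope.

(** If the [x_i] grow at most geometrically then so do the [P_n], so that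
    [S(z) = sum P_n z^n] converges near 0. The recursion says exactly
    [S' = S G'] with [G'(z) = sum (-1)^i x_(i+1) z^i]; hence [S exp(-G)] is
    constant and [S = exp G]. For [x_i = (1/p^i - 1) x - t] the geometric series
    sum to [G(z) = x ln ((1 + z/p)/(1 + z)) - t ln (1 + z)], and the coefficients
    of a power series near 0 are unique. *)

Lemma CV_radius_geom_bound (a : nat -> R) (B D z : R) :
  0 < D -> (forall n, Rabs (a n) <= B * D ^ n) -> Rabs z < / D ->
  Rbar_lt (Rabs z) (CV_radius a).
Proof.
intros HD Ha Hz.
apply Rbar_lt_le_trans with (/ D); [exact Hz|].
apply (proj1 (CV_radius_bounded a)); exists B; intros n.
rewrite Rabs_mult, pow_inv, (Rabs_right (/ D ^ n)).
- apply (Rmult_le_reg_r (D ^ n)); [now apply pow_lt|].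
  rewrite Rmult_assoc, Rinv_l, Rmult_1_r; [apply Ha|].
  now apply pow_nonzero, Rgt_not_eq.
- now apply Rle_ge, Rlt_le, Rinv_0_lt_compat, pow_lt.
Qed.

(** Outside the disk of convergence the terms do not tend to 0, so convergence at a single nonzero
    point rules out radius 0. *)
Lemma CV_radius_pos_of_ex_pseries (a : nat -> R) (z : R) :
  z <> 0 -> ex_pseries a z -> Rbar_lt 0 (CV_radius a).
Proof.
intros Hz Ha.
destruct (Rbar_lt_le_dec 0 (CV_radius a)) as [H|H]; [exact H|exfalso].
apply (CV_disk_outside a z).
- apply Rbar_le_lt_trans with 0; [exact H|now apply Rabs_pos_lt].
- apply ex_series_lim_0; destruct Ha as [l Hl]; exists l.
  now apply is_pseries_R.
Qed.

Lemma is_pseries_near_0_unique (a b : nat -> R) (f : R -> R) :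
  locally 0 (fun z : R => is_pseries a z (f z)) ->
  locally 0 (fun z : R => is_pseries b z (f z)) ->
  forall n, a n = b n.
Proof.
intros Ha Hb n.
assert (Hrad : forall c : nat -> R,
  locally 0 (fun z : R => is_pseries c z (f z)) -> Rbar_lt 0 (CV_radius c)).
{ intros c [e He].
  assert (He0 := cond_pos e).
  apply (CV_radius_pos_of_ex_pseries c (e / 2)); [lra|].
  (* Any nonzero point of the ball of radius [e] would do; [e / 2] is one. *)
  exists (f (e / 2)); apply He.
  change (Rabs (e / 2 + - 0) < e); rewrite Rabs_right; lra. }
apply PSeries_ext_recip; [now apply Hrad|now apply Hrad|].
generalize (filter_and _ _ Ha Hb); apply filter_imp; intros z [H1 H2].
now rewrite (is_pseries_unique _ _ _ H1), (is_pseries_unique _ _ _ H2).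
Qed.

(** The ratio [D = q * (A + 1)] dominates both [q] and [A * q]. By strong induction each of the
    [n + 1] summands of the recursion is then at most [D ^ (n - i) * (D * D ^ i) = D ^ S n], and the
    factor [1 / INR (S n)] cancels their number. *)
Lemma kailath_segall_geom_bound (x : nat -> R) (A q : R) :
  0 <= A -> 0 < q -> (forall i, Rabs (x (S i)) <= A * q ^ S i) ->
  forall n, Rabs (kailath_segall n x) <= (q * (A + 1)) ^ n.
Proof.
intros HA Hq Hx n.
set (D := q * (A + 1)).
assert (HqD : q <= D) by (unfold D; nra).
assert (HAD : A * q <= D) by (unfold D; nra).
induction n as [n IH] using (well_founded_induction lt_wf).
destruct n as [|n].
- rewrite kailath_segall_0, Rabs_R1; simpl; lra.
- assert (HS : 0 < INR (S n)) by (apply lt_0_INR; lia).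
  rewrite kailath_segall_S, Rabs_mult, Rabs_right
    by (apply Rle_ge, Rlt_le, Rdiv_lt_0_compat; lra).
  apply (Rmult_le_reg_l (INR (S n))); [exact HS|].
  rewrite <- Rmult_assoc.
  replace (INR (S n) * (1 / INR (S n))) with 1 by (field; lra).
  rewrite Rmult_1_l.
  eapply Rle_trans; [apply Rsum_abs|].
  rewrite (Rmult_comm (INR (S n))), <- sum_cte.
  apply sum_Rle; intros i Hi.
  rewrite !Rabs_mult, pow_1_abs, Rmult_1_l.
  replace (D ^ S n) with (D ^ (n - i) * (D * D ^ i)).
  + apply Rmult_le_compat; try apply Rabs_pos.
    * apply IH; lia.
    * eapply Rle_trans; [apply Hx|].
      simpl; rewrite <- Rmult_assoc.
      apply Rmult_le_compat; [nra|apply pow_le; lra|exact HAD|].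
      apply pow_incr; lra.
  + change (D * D ^ i) with (D ^ S i); rewrite <- pow_add.
    f_equal; lia.
Qed.

Lemma is_derive_zero_near_0_const (f : R -> R) (r : R) :
  (forall z, Rabs z < r -> is_derive f z 0) ->
  forall z, Rabs z < r -> f z = f 0.
Proof.
intros Hf z Hz; apply Rabs_def2 in Hz.
destruct (Rtotal_order z 0) as [H|[->|H]]; [|reflexivity|symmetry];
  apply (eq_is_derive f); try lra;
  intros y Hy; apply Hf, Rabs_def1; lra.
Qed.

(** [G] enters only through [G 0] and its derivative, so that a closed form with logarithms can be
    supplied later without expanding it as a series. *)
Lemma is_pseries_kailath_segall (x : nat -> R) (A q : R) (G : R -> R) :
  0 <= A -> 0 < q -> (forall i, Rabs (x (S i)) <= A * q ^ S i) ->
  G 0 = 0 ->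
  (forall z, Rabs z < / (q * (A + 1)) ->
     is_derive G z (PSeries (fun i => (-1) ^ i * x (S i)) z)) ->
  forall z, Rabs z < / (q * (A + 1)) ->
    is_pseries (fun n => kailath_segall n x) z (exp (G z)).
Proof.
intros HA Hq Hx HG0 HG.
set (D := q * (A + 1)) in *.
set (P := fun n => kailath_segall n x).
set (g := fun i => (-1) ^ i * x (S i)) in *.
assert (HD : 0 < D) by (unfold D; nra).
assert (HqD : q <= D) by (unfold D; nra).
assert (HP : forall z, Rabs z < / D -> Rbar_lt (Rabs z) (CV_radius P)).
{ intros z; apply (CV_radius_geom_bound P 1 D z HD); intros n.
  rewrite Rmult_1_l; now apply kailath_segall_geom_bound. }
assert (Hg : forall z, Rabs z < / D -> Rbar_lt (Rabs z) (CV_radius g)).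
{ intros z; apply (CV_radius_geom_bound g (A * q) D z HD); intros n.
  unfold g; rewrite Rabs_mult, pow_1_abs, Rmult_1_l.
  eapply Rle_trans; [apply Hx|]; simpl; rewrite <- Rmult_assoc.
  apply Rmult_le_compat_l; [nra|apply pow_incr; lra]. }
(* The recursion multiplied by [INR (S n)] is a Cauchy product: S' = G' S, coefficient by
   coefficient. *)
assert (HPg : forall n, PS_derive P n = PS_mult g P n).
{ intros n; unfold PS_derive, PS_mult, P, g.
  rewrite kailath_segall_S, <- Rmult_assoc.
  replace (INR (S n) * (1 / INR (S n))) with 1
    by (field; apply not_0_INR; lia).
  rewrite Rmult_1_l; apply sum_eq; intros i _; ring. }
(* The derivative is (S' - S G') exp(-G) = 0, and the value at 0 is P_0 = 1. *)
assert (Hconst : forall z, Rabs z < / D -> PSeries P z * exp (- G z) = 1).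
{ intros z Hz.
  replace 1 with (PSeries P 0 * exp (- G 0)).
  2:{ rewrite HG0, Ropp_0, exp_0, PSeries_0; unfold P.
      rewrite kailath_segall_0; ring. }
  apply (is_derive_zero_near_0_const
    (fun z => PSeries P z * exp (- G z)) (/ D)); [|exact Hz].
  intros y Hy.
  assert (H1 := is_derive_PSeries P y (HP y Hy)).
  rewrite (PSeries_ext _ _ y HPg), PSeries_mult in H1
    by (now apply Hg || now apply HP).
  assert (H2 := HG y Hy).
  auto_derive.
  - split; [now exists (PSeries g y * PSeries P y)|].
    split; [now exists (PSeries g y)|exact I].
  - change (fun z : R => PSeries P z) with (PSeries P).
    change (fun z : R => G z) with G.
    rewrite (is_derive_unique _ _ _ H1), (is_derive_unique _ _ _ H2); ring. }
intros z Hz.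
replace (exp (G z)) with (PSeries P z).
- apply PSeries_correct, CV_radius_inside, HP, Hz.
- rewrite <- (Rmult_1_l (exp (G z))), <- (Hconst z Hz), Rmult_assoc,
    <- exp_plus, Rplus_opp_l, exp_0; ring.
Qed.

Lemma is_pseries_alternating_geom (q z : R) :
  Rabs (q * z) < 1 ->
  is_pseries (fun i => (-1) ^ i * q ^ i) z (/ (1 + q * z)).
Proof.
intros Hz; apply is_pseries_R.
replace (1 + q * z) with (1 - - (q * z)) by ring.
apply (is_series_ext (fun n => (- (q * z)) ^ n)).
- intros n; rewrite <- !Rpow_mult_distr; f_equal; ring.
- apply is_series_geom; now rewrite Rabs_Ropp.
Qed.

Lemma kailath_segall_meixner_genfun (p x t : R) :
  0 < p < 1 ->
  locally 0 (fun z : R =>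
    is_pseries
      (fun n => kailath_segall n (fun i : nat => (1 / p ^ i - 1) * x - t)) z
      (Rpower ((1 + z / p) / (1 + z)) x * Rpower (1 + z) (- t))).
Proof.
intros Hp.
set (xs := fun i : nat => (1 / p ^ i - 1) * x - t).
set (q := / p).
assert (Hq : 1 < q) by (unfold q; rewrite <- Rinv_1; apply Rinv_lt_contravar; lra).
(* Since [1 <= q ^ i], |(q^i - 1) x - t| is at most (|x| + |t|) q^i. *)
set (A := Rabs x + Rabs t).
assert (Hx0 := Rabs_pos x); assert (Ht0 := Rabs_pos t).
assert (HA : 0 <= A) by (unfold A; lra).
set (D := q * (A + 1)).
assert (HD : 0 < D) by (unfold D; nra).
assert (Hxs : forall i, xs i = (q ^ i - 1) * x - t).
{ intros i; unfold xs, q; rewrite pow_inv; unfold Rdiv; ring. }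
(* The exponent obtained by unfolding both [Rpower] factors. *)
set (G := fun z => x * ln ((1 + z / p) / (1 + z)) + - t * ln (1 + z)).
exists (mkposreal (/ D) (Rinv_0_lt_compat _ HD)); intros z Hz.
change (Rabs (z + - 0) < / D) in Hz; rewrite Ropp_0, Rplus_0_r in Hz.
replace (Rpower _ _ * Rpower _ _) with (exp (G z))
  by (unfold G, Rpower; now rewrite exp_plus).
apply (is_pseries_kailath_segall xs A q); try assumption; try lra.
- intros i; rewrite Hxs.
  assert (1 <= q ^ S i) by (apply pow_R1_Rle; lra).
  unfold Rminus at 1; eapply Rle_trans; [apply Rabs_triang|].
  rewrite Rabs_Ropp, Rabs_mult, Rabs_right by lra.
  unfold A; nra.
- unfold G, Rdiv; rewrite Rmult_0_l, Rplus_0_r, Rinv_1, Rmult_1_r, ln_1; ring.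
- clear z Hz; intros z Hz; fold D in Hz.
  (* From [q <= D] and [1 < q], both |qz| and |z| are below 1: the two geometric series converge,
     and [1 + q * z] and [1 + z] are positive, as the logarithms require. *)
  assert (Hqz : Rabs (q * z) < 1).
  { rewrite Rabs_mult, (Rabs_right q) by lra.
    apply Rle_lt_trans with (D * Rabs z).
    - apply Rmult_le_compat_r; [apply Rabs_pos|unfold D; nra].
    - rewrite <- (Rinv_r D) by lra; now apply Rmult_lt_compat_l. }
  assert (H1z : Rabs (1 * z) < 1).
  { rewrite Rabs_mult, Rabs_right in Hqz by lra.
    rewrite Rmult_1_l; assert (H := Rabs_pos z); nra. }
  (* Splitting x_(i+1) = q x q^i - (x + t) gives two geometric series, of ratios -qz and -z; the
     second is the case [q = 1], whence [1 * z]. *)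
  assert (Hsum : is_pseries (fun i => (-1) ^ i * xs (S i)) z
            (q * x * / (1 + q * z) + - (x + t) * / (1 + 1 * z))).
  { assert (H1 := is_pseries_scal (q * x) _ z _ (Rmult_comm _ _)
                    (is_pseries_alternating_geom q z Hqz)).
    assert (H2 := is_pseries_scal (- (x + t)) _ z _ (Rmult_comm _ _)
                    (is_pseries_alternating_geom 1 z H1z)).
    eapply is_pseries_ext; [|exact (is_pseries_plus _ _ _ _ _ H1 H2)].
    intros i; rewrite Hxs; unfold PS_plus, PS_scal.
    change (q * x * ((-1) ^ i * q ^ i) + - (x + t) * ((-1) ^ i * 1 ^ i) =
            (-1) ^ i * ((q ^ S i - 1) * x - t)).
    rewrite pow1; simpl; ring. }
  rewrite (is_pseries_unique _ _ _ Hsum).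
  apply Rabs_def2 in Hqz; apply Rabs_def2 in H1z.
  rewrite Rmult_1_l in *.
  assert (Hzp : 1 + z / p = 1 + q * z) by (unfold q; field; lra).
  unfold G; auto_derive.
  + repeat split; try lra.
    change (0 < (1 + z / p) * / (1 + z)); rewrite Hzp.
    apply Rdiv_lt_0_compat; lra.
  (* Clearing denominators produces p + z = p (1 + qz), nonzero because qz > -1. *)
  + assert (p + z <> 0).
    { intros E; replace z with (- p) in Hqz by lra.
      unfold q in Hqz; rewrite <- Ropp_mult_distr_r, Rinv_l in Hqz; lra. }
    unfold q; field; repeat split; lra.
Qed.

Lemma pochhammer_pos (t : R) (k : nat) : 0 < t -> 0 < pochhammer t k.
Proof.
intros Ht; induction k as [|k IH]; simpl; [lra|].
apply Rmult_lt_0_compat; [exact IH|].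
assert (H := pos_INR k); lra.
Qed.

(** As [meixner] is chosen by [epsilon], it has its defining property once some sequence does. The
    witness solves the desired identity for M_k, dividing by (-1)^k (t)_k, which is nonzero for t >
    0; its generating function is then the Kailath-Segall one. *)
Lemma is_meixner_meixner (p x t : R) :
  0 < p < 1 -> 0 < t -> is_meixner x t p (fun k => meixner k x t p).
Proof.
intros Hp Ht.
apply (epsilon_spec (inhabits (fun _ : nat => 0)) (is_meixner x t p)).
exists (fun k =>
  INR (fact k) * kailath_segall k (fun i : nat => (1 / p ^ i - 1) * x - t) /
  ((-1) ^ k * pochhammer t k)).
unfold is_meixner; generalize (kailath_segall_meixner_genfun p x t Hp).
apply filter_imp; intros z; apply is_pseries_ext; intros k.
assert (H := pochhammer_pos t k Ht).
lazymatch goal with |- ?a = ?b => change (a = b :> R) end.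
field; repeat split;
  try apply INR_fact_neq_0; try (apply pow_nonzero; lra); lra.
Qed.

Theorem mainTheorem4 (p x t : R) (hp : 0 < p < 1) (ht : 0 < t) (k : nat) :
  INR (fact k) * kailath_segall k (fun i : nat => (1 / p ^ i - 1) * x - t) =
  (-1) ^ k * pochhammer t k * meixner k x t p.
Proof.
(* Comparing coefficients gives P_k = (-1)^k (t)_k M_k / k!. *)
assert (H := is_pseries_near_0_unique _ _ _
  (kailath_segall_meixner_genfun p x t hp) (is_meixner_meixner p x t hp ht) k).
cbv beta in H; rewrite H; field; apply INR_fact_neq_0.
Qed.
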